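(* Let $T\in(0,\infty)$, $\alpha_{-1},\alpha_0,\alpha_1,\alpha_2,\sigma>0$, $r,\rho>1$. For any step-size $h=T/N>0$, $N\in\mathbb N$, and any positive initial datum $Y_0=x_0>0$, the scheme $$Y_{n+1}=\Phi_h(Y_n)+\big(\alpha_{-1}Y_{n+1}^{-1}-\alpha_0+\alpha_1\Phi_h(Y_n)+f(\Phi_h(Y_n))\big)h+g(\Phi_h(Y_n))\Delta W_n+\tfrac12\big(|\Delta W_n|^2-h\big)\hat g(\Phi_h(Y_n)),$$ $n\in\{0,1,\dots,N-1\}$, with corrective mappings $\Phi_h:(0,\infty)\to(0,\infty)$ satisfying conditions (a)–(d) of the context, is well-defined and positivity preserving, i.e. it admits a unique positive $\{\mathcal F_{t_n}\}_{n=0}^N$-adapted solution $\{Y_n\}_{n=0}^N$.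
   Context: Let $D=(0,\infty)$, and let $\{W_t\}_{t\in[0,T]}$ be a standard real-valued Brownian motion on a filtered probability space $(\Omega,\mathcal F,\{\mathcal F_t\}_{t\in[0,T]},\mathbb P)$ (a Brownian motion with respect to this filtration). For $x\in D$ set $f(x)=-\alpha_2x^r$, $g(x)=\sigma x^\rho$, $\hat g(x)=g'(x)g(x)=\rho\sigma^2x^{2\rho-1}$. For $h=T/N$ put $t_n=nh$ and $\Delta W_n=W_{t_{n+1}}-W_{t_n}$. Conditions on the corrective mappings: $\Phi_h:D\to D$ is given for each $h=T/N$, $N\in\mathbb N$, and there exist constants $L_1,L_2,L_3\ge0$ such that for all $x,y\in D$ and all $h=T/N$, $N\in\mathbb N$: (a) $|\Phi_h(x)|\le|x|$; (b) $|x-\Phi_h(x)|\le L_1h(1+|x|^{2r+1})\,\min\{1,\ h(1+|x|^{2r})\}$; (c) $|\Phi_h(x)-\Phi_h(y)|\le(1+L_2h)|x-y|$; (d) $|f(\Phi_h(x))-f(\Phi_h(y))|^2+|\hat g(\Phi_h(x))-\hat g(\Phi_h(y))|^2\le L_3h^{-1}|x-y|^2$. *)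

(* Defs.v *)
From HB Require Import structures.
From mathcomp Require Import all_boot all_order all_algebra.
From mathcomp Require Import all_classical all_reals all_analysis.
From mathcomp Require Import ring.

Set Implicit Arguments.
Unset Strict Implicit.
Unset Printing Implicit Defensive.

Import Order.TTheory GRing.Theory Num.Theory.
Import numFieldNormedType.Exports.
Local Open Scope classical_set_scope.
Local Open Scope ring_scope.

Definition drift {R : realType} (alpha2 r x : R) : R := - alpha2 * x `^ r.

Definition diffusion {R : realType} (sigma rho x : R) : R := sigma * x `^ rho.

Definition diffusion_hat {R : realType} (sigma rho x : R) : R :=
  derive1 (diffusion sigma rho) x * diffusion sigma rho x.

Lemma diffusion_hatE {R : realType} (sigma rho x : R) : 0 < x ->
  diffusion_hat sigma rho x = rho * sigma ^+ 2 * x `^ (2 * rho - 1).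
Proof.
move=> x0.
have dp := is_derive1_powR rho x0.
have -> : diffusion_hat sigma rho x =
    sigma * (rho * x `^ (rho - 1)) * (sigma * x `^ rho).
  rewrite /diffusion_hat; congr (_ * _).
  rewrite derive1E.
  have -> : diffusion sigma rho = sigma \*: (@powR R ^~ rho) by [].
  by rewrite deriveZ // derive_val.
have -> : 2 * rho - 1 = (rho - 1) + rho by rewrite mulr_natl mulr2n addrAC.
rewrite [in RHS]powRD; last by rewrite (gt_eqF x0) implybT.
by ring.
Qed.

Section stochastic_basis.
Context {d : measure_display} {Omega : measurableType d} {R : realType}.
Implicit Types (F : R -> set (set Omega)) (W : R -> Omega -> R).

(* Only the indices in [0, T] are constrained; F is arbitrary elsewhere. *)
Definition is_filtration (T : R) F : Prop :=
  [/\ forall t : R, 0 <= t <= T -> sigma_algebra setT (F t),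
      forall t : R, 0 <= t <= T -> F t `<=` measurable
    & forall s t : R, 0 <= s -> s <= t -> t <= T -> F s `<=` F t].

Definition measurable_wrt (G : set (set Omega)) (X : Omega -> R) : Prop :=
  measurable_fun [set: g_sigma_algebraType G] (X : g_sigma_algebraType G -> R).

Definition independent_of (P : probability Omega R) (X : Omega -> R)
    (G : set (set Omega)) : Prop :=
  forall (A : set Omega) (B : set R), G A -> measurable B ->
    P (A `&` X @^-1` B) = (P A * P (X @^-1` B))%E.

Definition is_brownian_motion (P : probability Omega R) (T : R) F W : Prop :=
  [/\ forall t : R, 0 <= t <= T -> measurable_wrt (F t) (W t),
      {ae P, forall w, W 0 w = 0},
      forall s t : R, 0 <= s -> s < t -> t <= T ->
        independent_of P (W t \- W s) (F s),
      (* the second parameter of [normal_prob] is the standard deviation *)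
      forall s t : R, 0 <= s -> s < t -> t <= T ->
        forall B : set R, measurable B ->
          P ((W t \- W s) @^-1` B) = normal_prob 0 (Num.sqrt (t - s)) B
    & {ae P, forall w, {within `[0, T], continuous (fun t => W t w)}}].

End stochastic_basis.

(* Phi h stands for the map Phi_h on (0, oo); its values outside (0, oo), and
   the maps Phi h for h not of the form T / N with N >= 1, are irrelevant. *)
Definition corrective_mappings {R : realType} (T alpha2 sigma r rho : R)
    (Phi : R -> R -> R) : Prop :=
  let f := drift alpha2 r in
  let ghat := diffusion_hat sigma rho in
  (forall N : nat, (0 < N)%N -> forall x : R, 0 < x -> 0 < Phi (T / N%:R) x) /\
  exists L1 L2 L3 : R,
    [/\ 0 <= L1, 0 <= L2, 0 <= L3 &
     forall (x y : R) (N : nat), 0 < x -> 0 < y -> (0 < N)%N ->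
     let h := T / N%:R in
     [/\ `|Phi h x| <= `|x|,
         `|x - Phi h x| <= L1 * h * (1 + `|x| `^ (2 * r + 1))
                           * Num.min 1 (h * (1 + `|x| `^ (2 * r))),
         `|Phi h x - Phi h y| <= (1 + L2 * h) * `|x - y|
       & `|f (Phi h x) - f (Phi h y)| ^+ 2
         + `|ghat (Phi h x) - ghat (Phi h y)| ^+ 2
         <= L3 * h^-1 * `|x - y| ^+ 2]].

Section scheme.
Context {d : measure_display} {Omega : measurableType d} {R : realType}.
Variables (alpham1 alpha0 alpha1 alpha2 sigma r rho T : R).
Variables (Phi : R -> R -> R) (W : R -> Omega -> R) (N : nat) (x0 : R).

(* The equations are imposed for every sample point w, for the values of Y at
   the indices 0, ..., N only. *)
Definition solves_scheme (Y : nat -> Omega -> R) : Prop :=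
  let h := T / N%:R in
  let f := drift alpha2 r in
  let g := diffusion sigma rho in
  let ghat := diffusion_hat sigma rho in
  (forall w, Y 0%N w = x0) /\
  forall n, (n < N)%N -> forall w,
    let z := Phi h (Y n w) in
    let dW := W (n.+1%:R * h) w - W (n%:R * h) w in
    Y n.+1 w =
      z + (alpham1 * (Y n.+1 w)^-1 - alpha0 + alpha1 * z + f z) * h
      + g z * dW + 2^-1 * (`|dW| ^+ 2 - h) * ghat z.

Definition positive_process (Y : nat -> Omega -> R) : Prop :=
  forall n, (n <= N)%N -> forall w, 0 < Y n w.

Definition adapted_process (F : R -> set (set Omega)) (Y : nat -> Omega -> R)
    : Prop :=
  forall n, (n <= N)%N -> measurable_wrt (F (n%:R * (T / N%:R))) (Y n).

Definition positive_adapted_solution (F : R -> set (set Omega))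
    (Y : nat -> Omega -> R) : Prop :=
  [/\ solves_scheme Y, positive_process Y & adapted_process F Y].

End scheme.

(* Main.v *)
Require Import Defs.
From HB Require Import structures.
From mathcomp Require Import all_boot all_order all_algebra.
From mathcomp Require Import all_classical all_reals all_analysis.
From mathcomp Require Import measurable_realfun ring lra.
Import Order.TTheory GRing.Theory Num.Theory.
Import numFieldNormedType.Exports.
Local Open Scope classical_set_scope.
Local Open Scope ring_scope.

(** The scheme is implicit only through the term [alpham1 * h / Y_(n+1)]. Given
    the state [Y_n] and the Brownian increment, all other terms on the right
    combine into a number [b], and the new state has to satisfy
    [y = b + c / y] with [c = alpham1 * h > 0]. Multiplying by [y] gives
    [y ^ 2 - b * y - c = 0], whose roots have product [- c < 0]: whatever the
    sign of [b], exactly one of them is positive. This is [positive_rootP] and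
    [positive_root_gt0]; together they say that a positive solution exists
    step by step and that no other choice is possible, for every sample point.

    Adaptedness is a matter of measurability. The positive root is a continuous
    function of [b], and [b] is built from the increment and [Phi_h (Y_n)] by
    sums, products and powers ([measurable_explicit_part]). The only data not
    given by a formula is [Phi_h] itself: condition (c) makes it Lipschitz on
    (0, oo), hence Borel there ([lipschitz_measurable_fun]), and [Y_n] takes its
    values in that interval. *)

Definition positive_root {R : realType} (c b : R) : R :=
  (b + Num.sqrt (b ^+ 2 + 4 * c)) / 2.

(** The square root exceeds [|b|] because the discriminant exceeds [b ^ 2]. *)
Lemma positive_root_gt0 {R : realType} (c b : R) : 0 < c -> 0 < positive_root c b.
Proof.
move=> c_gt0; rewrite /positive_root divr_gt0// -ltrBlDl sub0r.
apply: (@le_lt_trans _ _ `|b|); first by rewrite -normrN ler_norm.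
by rewrite -sqrtr_sqr ltr_sqrt; nra.
Qed.

(** For [y > 0] the equation is equivalent to [(2 y - b) ^ 2 = b ^ 2 + 4 c], and
    it forces [2 y - b = y + c / y > 0], which selects the sign of the square
    root. *)
Lemma positive_rootP {R : realType} (c b y : R) : 0 < c -> 0 < y ->
  y = b + c * y^-1 <-> y = positive_root c b.
Proof.
move=> c_gt0 y_gt0; rewrite /positive_root; split=> [y_eq|y_eq].
- have cE : c = y * (y - b).
    rewrite [X in _ * (X - b)]y_eq; field.
    by rewrite gt_eqF.
  have -> : b ^+ 2 + 4 * c = (2 * y - b) ^+ 2 by rewrite cE; ring.
  have yb : 0 <= 2 * y - b.
    rewrite {2}y_eq in cE.
    have : 0 < c * y^-1 by rewrite divr_gt0.
    by lra.
  by rewrite sqrtr_sqr ger0_norm//; field.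
- have disc_ge0 : 0 <= b ^+ 2 + 4 * c by nra.
  have := sqr_sqrtr disc_ge0; set s := Num.sqrt _ in y_eq * => s2.
  have cE : c = y * (y - b).
    have -> : c = (s ^+ 2 - b ^+ 2) / 4 by rewrite s2; field.
    by rewrite y_eq; field.
  by rewrite cE; field; rewrite gt_eqF.
Qed.

Lemma measurable_positive_root {R : realType} (c : R) :
  measurable_fun [set: R] (positive_root c).
Proof.
apply: measurable_funM => //; apply: measurable_funD => //.
apply: (@measurableT_comp _ _ _ _ _ _ (@Num.sqrt R)).
  by apply: continuous_measurable_fun; exact: sqrt_continuous.
by apply: measurable_funD => //; exact: measurable_funX.
Qed.

(** A Lipschitz function on [A] is continuous for the subspace topology of [A],
    and the open sets of that topology are Borel. *)
Lemma lipschitz_measurable_fun {R : realType} (A : set R) (k : R) (f : R -> R) :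
  measurable A ->
  (forall x y, A x -> A y -> `|f x - f y| <= k * `|x - y|) ->
  measurable_fun A f.
Proof.
move=> mA lipf; apply: subspace_continuous_measurable_fun => //.
rewrite continuous_subspace_in => x /set_mem Ax.
apply/cvgrPdist_le => e e_gt0; rewrite -nbhs_subspace_in//.
(* [k] may be zero or negative, so a positive constant is substituted for it. *)
have K_gt0 : 0 < `|k| + 1 by rewrite ltr_wpDl.
rewrite near_withinE.
near=> y => Ay; rewrite (le_trans (lipf _ _ Ax Ay))//.
apply: (@le_trans _ _ ((`|k| + 1) * `|x - y|)).
  by rewrite ler_wpM2r// (le_trans (ler_norm k))// lerDl.
rewrite -ler_pdivlMl// mulrC.
near: y; apply: cvgr_dist_le; first exact: cvg_id.
by rewrite divr_gt0.
Unshelve. all: by end_near. Qed.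

(** In a filtration this brings [Y_n] and [W_(t_n)], known at time [t_n], to the
    time [t_(n+1)] at which they are combined with [W_(t_(n+1))]. *)
Lemma measurable_wrtS {d : measure_display} {Omega : measurableType d}
    {R : realType} (G H : set (set Omega)) (X : Omega -> R) :
  G `<=` H -> measurable_wrt G X -> measurable_wrt H X.
Proof.
move=> GH mX _ B mB.
have := mX measurableT B mB.
exact: sub_sigma_algebra2.
Qed.

(** The right-hand side of the scheme without its term in [Y_(n+1)], as a
    function of [z = Phi_h (Y_n)] and of the increment [dW]. *)
Definition explicit_part {R : realType} (alpha0 alpha1 alpha2 sigma r rho h : R)
    (z dW : R) : R :=
  z + (- alpha0 + alpha1 * z + drift alpha2 r z) * h
  + diffusion sigma rho z * dW
  + 2^-1 * (`|dW| ^+ 2 - h) * diffusion_hat sigma rho z.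

(** Positivity of [z] is what allows [diffusion_hat], defined by a derivative,
    to be replaced by its closed form, a power of [z]. *)
Lemma measurable_explicit_part {d : measure_display} {X : measurableType d}
    {R : realType} (alpha0 alpha1 alpha2 sigma r rho h : R) (z dW : X -> R) :
  (forall w, 0 < z w) ->
  measurable_fun [set: X] z -> measurable_fun [set: X] dW ->
  measurable_fun [set: X]
    (fun w => explicit_part alpha0 alpha1 alpha2 sigma r rho h (z w) (dW w)).
Proof.
move=> z_gt0 mz mdW.
have mpow p : measurable_fun [set: X] (fun w => z w `^ p).
  by apply: (measurableT_comp (measurable_powR p)).
have mghat : measurable_fun [set: X] (fun w => diffusion_hat sigma rho (z w)).
  apply: (@eq_measurable_fun _ _ _ _ _
    (fun w => rho * sigma ^+ 2 * z w `^ (2 * rho - 1))).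
    by move=> w _; rewrite diffusion_hatE.
  exact: measurable_funM.
apply: measurable_funD; last first.
  apply: measurable_funM mghat; apply: measurable_funM => //.
  apply: measurable_funB => //; apply: measurable_funX.
  exact: measurableT_comp.
apply: measurable_funD; last by do 2!apply: measurable_funM => //.
apply: measurable_funD => //; apply: measurable_funM => //.
apply: measurable_funD; last exact: measurable_funM.
by apply: measurable_funD => //; exact: measurable_funM.
Qed.

Definition implicit_step {R : realType}
    (alpham1 alpha0 alpha1 alpha2 sigma r rho h z dW : R) : R :=
  positive_root (alpham1 * h)
    (explicit_part alpha0 alpha1 alpha2 sigma r rho h z dW).

(** One step of the scheme, solved for its new positive state: the bridge
    through which both existence and uniqueness are read off. *)
Lemma implicit_stepP {R : realType}
    (alpham1 alpha0 alpha1 alpha2 sigma r rho h z dW y : R) :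
  0 < alpham1 -> 0 < h -> 0 < y ->
  y = z + (alpham1 * y^-1 - alpha0 + alpha1 * z + drift alpha2 r z) * h
      + diffusion sigma rho z * dW
      + 2^-1 * (`|dW| ^+ 2 - h) * diffusion_hat sigma rho z
  <-> y = implicit_step alpham1 alpha0 alpha1 alpha2 sigma r rho h z dW.
Proof.
move=> alpham1_gt0 h_gt0 y_gt0.
rewrite -positive_rootP ?mulr_gt0//.
set lhs := (X in y = X <-> _); set rhs := (X in _ <-> y = X).
suff -> : lhs = rhs by [].
by rewrite /lhs /rhs /explicit_part; ring.
Qed.

Theorem lemma3p2 (R : realType) (d : measure_display) (Omega : measurableType d)
    (P : probability Omega R) (T : R) (F : R -> set (set Omega))
    (W : R -> Omega -> R)
    (alpham1 alpha0 alpha1 alpha2 sigma r rho : R) (Phi : R -> R -> R)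
    (T_gt0 : 0 < T) (filtrationF : is_filtration T F)
    (brownianW : is_brownian_motion P T F W)
    (alpham1_gt0 : 0 < alpham1) (alpha0_gt0 : 0 < alpha0)
    (alpha1_gt0 : 0 < alpha1) (alpha2_gt0 : 0 < alpha2) (sigma_gt0 : 0 < sigma)
    (r_gt1 : 1 < r) (rho_gt1 : 1 < rho)
    (correctivePhi : corrective_mappings T alpha2 sigma r rho Phi)
    (N : nat) (N_gt0 : (0 < N)%N) (x0 : R) (x0_gt0 : 0 < x0) :
  let solution := positive_adapted_solution alpham1 alpha0 alpha1 alpha2 sigma
                    r rho T Phi W N x0 F in
  exists Y : nat -> Omega -> R,
    solution Y /\
    forall Y' : nat -> Omega -> R, solution Y' ->
      forall n : nat, (n <= N)%N -> forall w : Omega, Y' n w = Y n w.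
Proof.
move=> solution.
have [_ _ monoF] := filtrationF.
have [adaptedW _ _ _ _] := brownianW.
have [Phi_gt0 [L1 [L2 [L3 [_ _ _ boundsPhi]]]]] := correctivePhi.
pose h := T / N%:R.
have h_gt0 : 0 < h by rewrite divr_gt0 ?ltr0n.
have Phih_gt0 : forall x, 0 < x -> 0 < Phi h x := Phi_gt0 N N_gt0.
have mPhih : measurable_fun (`]0, +oo[%classic : set R) (Phi h).
  apply: (@lipschitz_measurable_fun _ _ (1 + L2 * h)) => //= x y.
  rewrite !in_itv/= !andbT => x_gt0 y_gt0.
  by have [] := boundsPhi x y N x_gt0 y_gt0 N_gt0.
pose step := implicit_step alpham1 alpha0 alpha1 alpha2 sigma r rho h.
pose Y := fix Y n w := if n is m.+1
  then step (Phi h (Y m w)) (W (m.+1%:R * h) w - W (m%:R * h) w) else x0.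
have Y_gt0 n w : 0 < Y n w.
  by case: n => [//|n]; rewrite positive_root_gt0// mulr_gt0.
have timeP n : (n <= N)%N -> 0 <= n%:R * h <= T.
  move=> nN; rewrite mulr_ge0 ?ler0n ?(ltW h_gt0)//=.
  have -> : T = N%:R * h by rewrite mulrC divfK// pnatr_eq0 -lt0n.
  by rewrite ler_wpM2r ?ler_nat// ltW.
exists Y; split; first split.
- split=> // n nN w /=; rewrite -/h.
  by apply/implicit_stepP => //; exact: (Y_gt0 n.+1 w).
- by move=> n _ w.
- elim=> [|n IHn] nN; first exact: measurable_cst.
  have FnS : F (n%:R * h) `<=` F (n.+1%:R * h).
    have /andP[tn_ge0 _] := timeP n (ltnW nN).
    have /andP[_ tn_leT] := timeP n.+1 nN.
    by apply: monoF => //; rewrite ler_wpM2r ?ler_nat// ltW.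
  have mYn := measurable_wrtS _ _ _ FnS (IHn (ltnW nN)).
  have mWn := measurable_wrtS _ _ _ FnS (adaptedW _ (timeP n (ltnW nN))).
  have mWSn := adaptedW _ (timeP n.+1 nN).
  have mz : measurable_wrt (F (n.+1%:R * h)) (fun w => Phi h (Y n w)).
    apply: (measurable_comp _ _ mPhih mYn) => //.
    by move=> _ [w _ <-]; rewrite /= in_itv/= Y_gt0.
  have mdW : measurable_wrt (F (n.+1%:R * h))
      (fun w => W (n.+1%:R * h) w - W (n%:R * h) w).
    exact: measurable_funB mWSn mWn.
  apply: (measurableT_comp (measurable_positive_root (alpham1 * h))).
  by apply: measurable_explicit_part mz mdW => w; exact: Phih_gt0.
- move=> Y' [[Y'0 Y'S] Y'_gt0 _]; elim=> [|n IHn] nN w; first exact: Y'0.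
  have -> : Y' n.+1 w =
      step (Phi h (Y' n w)) (W (n.+1%:R * h) w - W (n%:R * h) w).
    by apply/implicit_stepP => //; [exact: Y'_gt0|exact: Y'S].
  by rewrite (IHn (ltnW nN)).
Qed.
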